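(* Let $d\ge 2$ be an integer and let $k\ge 0$ be an integer. There exists an integer $N=N(d,k)$ such that every finite simple $2d$-regular graph $G$ having exactly $k$ connected components with an odd number of vertices, each of which has at least $N$ vertices, admits an antimagic orientation. *)

(* Defs.v *)
From HB Require Import structures.
From mathcomp Require Import all_boot all_order all_algebra.
Set Implicit Arguments. Unset Strict Implicit. Unset Printing Implicit Defensive.
Import GRing.Theory Num.Theory.

Definition simple_graph (T : finType) (e : rel T) : Prop :=
  symmetric e /\ irreflexive e.

Definition regular (T : finType) (e : rel T) (r : nat) : Prop :=
  forall x : T, #|[set y | e x y]| = r.

Definition components (T : finType) (e : rel T) : {set {set T}} :=
  [set [set y | connect e x y] | x : T].

Definition odd_components (T : finType) (e : rel T) : {set {set T}} :=
  [set C in components e | odd #|C|].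

Definition orientation (T : finType) (e : rel T) (D : rel T) : Prop :=
  (forall x y, D x y -> e x y) /\ (forall x y, e x y -> D x y (+) D y x).

Definition arcs (T : finType) (D : rel T) : {set T * T} :=
  [set a : T * T | D a.1 a.2].

Definition vsum (T : finType) (D : rel T) (L : T * T -> nat) (v : T) : int :=
  (\sum_(u | D u v) (L (u, v))%:Z - \sum_(w | D v w) (L (v, w))%:Z)%R.

(* An antimagic orientation: an orientation D together with a bijection L
   from the arcs (equivalently the edges) onto {1, ..., m} (m = number of
   edges) such that the oriented vertex sums are pairwise distinct. *)
Definition antimagic_orientation (T : finType) (e : rel T) : Prop :=
  exists D : rel T, orientation e D /\
  exists L : T * T -> nat,
    {in arcs D &, injective L} /\
    (forall a, a \in arcs D -> 1 <= L a <= #|arcs D|) /\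
    injective (vsum D L).

(* Main.v *)
Require Import Defs.
From HB Require Import structures.
From mathcomp Require Import all_boot all_order all_algebra.
From mathcomp Require Import zify.

Set Implicit Arguments.
Unset Strict Implicit.
Unset Printing Implicit Defensive.
Import GRing.Theory.

(** Take an Euler tour of each component and cut it at the last visit of every
    vertex, so that a component with [n] vertices yields [n] segments
    [f_0, ..., f_(n-1)] arranged in a cycle through all its vertices.  Direct
    [f_j] along the tour for even [j] and against it for odd [j], and give
    every segment an interval of labels increasing along its direction.  A
    visit inside a segment then contributes exactly [-1], so the sum at a
    vertex is a constant plus the contribution of the two segments meeting
    there: both enter it (a sink, contributing the two largest labels), or both
    leave it (a source, contributing minus the two smallest labels), or, at
    the base point of a component of odd order, one enters and one leaves.

    Only the order of the intervals remains to be chosen.  Along a cycle the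
    zigzag order [f_0, f_(n-1), f_1, f_(n-2), ...] makes the pairs of segments
    meeting at sinks (and at sources) a chain for the componentwise order, so
    their sums are distinct.  The odd components come first and are traversed
    simultaneously, level by level; the even ones follow one by one.  The
    lowest intervals are the [f_0] of the odd components, then their
    [f_(n-1)].  Since [d >= 2], [f_0] has at least two edges while [f_(n-1)]
    has exactly one, so the sums at the base points strictly decrease from one
    odd component to the next; they lie below all sinks and above all sources. *)

(** * Walks and their edges as undirected multisets *)

Section Walks.
Variable T : eqType.
Implicit Types (x y v : T) (p q : seq T) (a : T * T) (A : seq (T * T)).

Definition flip a := (a.2, a.1).

Fixpoint walk_arcs x p :=
  if p is y :: p' then (x, y) :: walk_arcs y p' else [::].

(** Each arc is listed in both directions, so multiplicities in [und A] are those of undirected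
    edges. *)
Definition und A := A ++ map flip A.

Lemma flipK : involutive flip.
Proof. by case. Qed.

Lemma flip_inj : injective flip.
Proof. exact: inv_inj flipK. Qed.

Lemma flip_eq a b : (flip b == a) = (b == flip a).
Proof. by rewrite -(inj_eq flip_inj) flipK. Qed.

Lemma walk_arcs_cat x p q :
  walk_arcs x (p ++ q) = walk_arcs x p ++ walk_arcs (last x p) q.
Proof. by elim: p x => //= y p IHp x; rewrite IHp. Qed.

Lemma size_walk_arcs x p : size (walk_arcs x p) = size p.
Proof. by elim: p x => //= y p IHp x; rewrite IHp. Qed.

Lemma walk_arcs_tails x p : map fst (walk_arcs x p) = belast x p.
Proof. by elim: p x => //= y p IHp x; rewrite IHp. Qed.

Lemma walk_arcs_heads x p : map snd (walk_arcs x p) = p.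
Proof. by elim: p x => //= y p IHp x; rewrite IHp. Qed.

Lemma last_rev_belast x p : last (last x p) (rev (belast x p)) = x.
Proof. by case: p => //= y p; rewrite rev_cons last_rcons. Qed.

Lemma walk_arcs_rev x p :
  walk_arcs (last x p) (rev (belast x p)) = rev (map flip (walk_arcs x p)).
Proof.
elim: p x => //= y p IHp x.
by rewrite !rev_cons -cats1 walk_arcs_cat IHp last_rev_belast cats1.
Qed.

Lemma count_und a A :
  count_mem a (und A) = count_mem a A + count_mem (flip a) A.
Proof.
rewrite count_cat count_map; congr (_ + _); apply: eq_count => b /=.
by rewrite flip_eq.
Qed.

Lemma und_flip a A : (flip a \in und A) = (a \in und A).
Proof. by rewrite -!has_pred1 !has_count !count_und flipK addnC. Qed.

(** Reversal flips every arc and so keeps the edges; this allows a segment to be directed against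
    the tour. *)
Lemma count_und_rev a x p :
  count_mem a (und (walk_arcs (last x p) (rev (belast x p)))) =
  count_mem a (und (walk_arcs x p)).
Proof.
rewrite walk_arcs_rev count_und !count_rev !count_map count_und addnC.
by congr (_ + _); apply: eq_count => b /=; rewrite flip_eq ?flipK.
Qed.

Lemma perm_und A A' : perm_eq A A' -> perm_eq (und A) (und A').
Proof. by move=> AA'; rewrite perm_cat // perm_map. Qed.

Lemma perm_und_cons a A : perm_eq (und (a :: A)) [:: a, flip a & und A].
Proof. by apply/permP => P; rewrite /und /= !count_cat /=; lia. Qed.

Lemma count_tail_und v A :
  count (fun a => a.1 == v) (und A) =
  count_mem v (map fst A) + count_mem v (map snd A).
Proof. by rewrite count_cat !count_map. Qed.

(** Both sides count [v] in [x :: p], with either the first or the last vertex split off. *)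
Lemma count_belast v x p :
  count_mem v p + (x == v) = count_mem v (belast x p) + (last x p == v).
Proof. by elim: p x => //= y p IHp x; rewrite addnC -addnA -IHp; lia. Qed.

Lemma count_und_flatten (I : Type) a (g : I -> seq (T * T)) s :
  count_mem a (und (flatten (map g s))) =
  \sum_(v <- s) count_mem a (und (g v)).
Proof.
elim: s => [|v s IHs]; first by rewrite big_nil.
by rewrite big_cons -IHs !count_und /= !count_cat; lia.
Qed.

End Walks.


(** * Euler tours *)

Section EulerTour.
Variables (T : finType) (e : rel T).
Hypotheses (esym : symmetric e) (eirr : irreflexive e).
Implicit Types (x y v w : T) (p : seq T).

Lemma count_und_degree v (A : seq (T * T)) :
    (forall a, a.1 = v -> count_mem a (und A) = e a.1 a.2) ->
  count (fun a => a.1 == v) (und A) = #|[set w | e v w]|.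
Proof.
move=> cA; pose s := [seq (v, w) | w <- enum [set w | e v w]].
have -> : #|[set w | e v w]| = size s by rewrite size_map -cardE.
rewrite -size_filter; apply: perm_size.
apply/allP => a _ /=; rewrite count_filter.
have us : uniq s by rewrite map_inj_uniq ?enum_uniq // => ? ? [].
rewrite (count_uniq_mem _ us); have [av|av] := eqVneq a.1 v.
  rewrite (@eq_count _ _ (pred1 a)); last first.
    by move=> b /=; case: eqP => //= ->; rewrite av eqxx.
  rewrite cA //; apply/eqP; congr nat_of_bool; apply/idP/mapP.
    by move=> eaa; exists a.2; rewrite ?mem_enum ?inE -?av //; case: (a).
  by case=> w; rewrite mem_enum inE => evw ->.
rewrite (@eq_count _ _ pred0) ?count_pred0; last first.
  by move=> b /=; case: eqP => //= ->; apply/negbTE.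
by apply/eqP; case: mapP => // -[w _ aE]; rewrite aE eqxx in av.
Qed.

(** Uniqueness of [und] rules out using an edge twice, in either direction. *)
Definition trail x p := path e x p && uniq (und (walk_arcs x p)).

Lemma path_arcs x p a : path e x p -> a \in walk_arcs x p -> e a.1 a.2.
Proof.
elim: p x => //= y p IHp x /andP[exy yp]; rewrite inE => /predU1P[-> //|].
exact: IHp yp.
Qed.

Lemma path_und x p a : path e x p -> a \in und (walk_arcs x p) -> e a.1 a.2.
Proof.
move=> xp; rewrite mem_cat => /orP[/(path_arcs xp) //|/mapP[b bA ->]] /=.
by rewrite esym; apply: path_arcs bA.
Qed.

Lemma mem_und_walk x p a : a \in und (walk_arcs x p) -> a.1 \in x :: p.
Proof.
rewrite mem_cat => /orP[aA|/mapP[b bA ->]] /=.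
  by apply: mem_belast; rewrite -walk_arcs_tails map_f.
have := map_f snd bA; rewrite walk_arcs_heads inE => ->.
by rewrite orbT.
Qed.

Lemma trail_cons w y p :
  trail y p -> e w y -> (y, w) \notin und (walk_arcs y p) -> trail w (y :: p).
Proof.
case/andP=> yp uA ewy nA.
have wyN : (w, y) != (y, w).
  by apply: contraTneq ewy => -[-> _]; rewrite eirr.
have nA' : (w, y) \notin und (walk_arcs y p) by rewrite -(und_flip (w, y)).
rewrite /trail (perm_uniq (perm_und_cons _ _)) /= ewy yp inE negb_or wyN.
by rewrite nA' nA.
Qed.

(** Split at an occurrence of [v] and exchange the two parts. This carries the maximality of a trail
    from its start to every vertex it visits. *)
Lemma trail_rot y p v : trail y p -> last y p = y -> v \in p ->
  exists q, [/\ trail v q, last v q = v, size q = size p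
              & perm_eq (walk_arcs v q) (walk_arcs y p)].
Proof.
move=> /andP[yp uA] lp vp; case/splitPr: vp yp uA lp => p1 p2.
rewrite cat_path /= last_cat /= => /and3P[yp1 evp vp2] uA lp.
have pe : perm_eq (walk_arcs v (p2 ++ rcons p1 v))
                  (walk_arcs y (p1 ++ v :: p2)).
  rewrite -cat_rcons !walk_arcs_cat lp last_rcons.
  by rewrite perm_catC.
exists (p2 ++ rcons p1 v); split=> //.
- rewrite /trail (perm_uniq (perm_und pe)) uA andbT.
  by rewrite cat_path vp2 lp rcons_path yp1.
- by rewrite last_cat last_rcons.
- by rewrite !size_cat size_rcons /= addnC addSn addnS.
Qed.

Lemma connect_walk_mem y p :
    (forall v w, v \in y :: p -> e v w -> w \in y :: p) ->
  forall z, connect e y z -> z \in y :: p.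
Proof.
move=> cl z /connectP[q + ->]; have := mem_head y p.
move: {1 3 4}y; elim: q => //= w q IHq x xin /andP[exw wq].
by apply: IHq wq; apply: cl exw.
Qed.

Lemma euler_tour x : (forall v, ~~ odd #|[set w | e v w]|) ->
  exists y p, [/\ connect e x y, path e y p, last y p = y
    & forall a, count_mem a (und (walk_arcs y p)) =
                (connect e x a.1 && e a.1 a.2)].
Proof.
move=> evd.
pose P n := [exists y, [exists p : n.-tuple T, connect e x y && trail y p]].
have P0 : exists n, P n.
  exists 0; apply/existsP; exists x; apply/existsP; exists [tuple].
  by rewrite connect0.
have PM n : P n -> n <= #|{: T * T}|.
  case/existsP=> y /existsP[p /and3P[_ _]].
  rewrite cat_uniq => /and3P[uA _ _].
  by rewrite -(size_tuple p) -(size_walk_arcs y) -(card_uniqP uA) max_card.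
case: (ex_maxnP P0 PM) => M /existsP[y /existsP[p /andP[cxy tr]]] maxM.
have full v q : connect e x v -> trail v q -> size q = M ->
    forall w, e v w -> (v, w) \in und (walk_arcs v q).
  move=> cxv trq sq w evw; apply: contraT => nA.
  suff /maxM : P M.+1 by rewrite ltnn.
  apply/existsP; exists w; rewrite -sq.
  apply/existsP; exists (in_tuple (v :: q)) => /=.
  rewrite trail_cons // ?andbT; last by rewrite esym.
  exact: connect_trans cxv (connect1 evw).
have fully := full _ _ cxy tr (size_tuple p).
have [yp uA] := andP tr.
have lp : last y p = y.
  apply/eqP; have cE : count (fun a => a.1 == y) (und (walk_arcs y p)) =
                       #|[set w | e y w]|.
    apply: count_und_degree => a ay.
    rewrite count_uniq_mem //; congr nat_of_bool; apply/idP/idP.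
      exact: path_und.
    by move: a ay => [a1 a2] /= ->; apply: fully.
  move: cE; rewrite count_tail_und walk_arcs_tails walk_arcs_heads => cE.
  have := count_belast y y p; rewrite eqxx.
  by have := evd y; rewrite -cE; case: (_ == y) => //; lia.
have fullv v : v \in y :: p ->
    forall w, e v w -> (v, w) \in und (walk_arcs y p).
  rewrite inE => /predU1P[-> //|vp] w evw.
  have [q [trq _ sq pe]] := trail_rot tr lp vp.
  rewrite -(perm_mem (perm_und pe)); apply: full; rewrite ?sq ?size_tuple //.
  by apply: connect_trans cxy _; apply: (path_connect yp); rewrite inE vp orbT.
have csym : connect_sym e by apply: sym_connect_sym.
have vis z : connect e x z -> z \in y :: p.
  move=> cxz; apply: connect_walk_mem => [v w vin evw|]; last first.
    by apply: connect_trans cxz; rewrite csym.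
  have := fullv v vin w evw; rewrite -und_flip; exact: mem_und_walk.
exists y, p; split=> // a; rewrite count_uniq_mem //; congr nat_of_bool.
apply/idP/andP=> [aA|[ca ea]].
  split; last exact: path_und aA.
  apply: connect_trans cxy _; apply: (path_connect yp); exact: mem_und_walk aA.
by move: a ca ea => [a1 a2] /= ca; apply: fullv; apply: vis.
Qed.

End EulerTour.

(** * Cutting a tour into segments *)

Section Cut.
Variable T : eqType.
Implicit Types (x y v z : T) (p q s : seq T) (ss : seq (seq T)).

(* Like [undup], [cut] refers to the last occurrence of each vertex. *)
Fixpoint cut p : seq (seq T) :=
  if p is y :: p' then
    if y \in p' then (if cut p' is s :: ss then (y :: s) :: ss else [::])
    else [:: y] :: cut p'
  else [::].

Lemma cut_nilP p : cut p = [::] -> p = [::].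
Proof.
elim: p => //= y p IHp; case: ifP => // yp.
by case E: (cut p) => [|s ss] //; rewrite IHp in yp.
Qed.

Lemma flatten_cut p : flatten (cut p) = p.
Proof.
elim: p => //= y p IHp; case: ifP => yp /=; last by rewrite IHp.
case E: (cut p) => [|s ss]; first by rewrite (cut_nilP E) in yp.
by rewrite -[in RHS]IHp E.
Qed.

Lemma cut_neq_nil p : [::] \notin cut p.
Proof.
elim: p => //= y p; case: ifP => yp //.
by case: (cut p) => [|s ss] //; rewrite !inE !negb_or => /andP[].
Qed.

(** Hence segments correspond to vertices through their ends, in the order of last visits. *)
Lemma last_cut x p : map (last x) (cut p) = undup p.
Proof.
elim: p => //= y p IHp; case: ifP => yp /=; last by rewrite IHp.
rewrite -IHp; case E: (cut p) => [|s ss] //=.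
by case: s E => // E; have := cut_neq_nil p; rewrite E inE eqxx.
Qed.

Lemma size_cut p : size (cut p) = size (undup p).
Proof.
case: p => // y p; by rewrite -(last_cut y) size_map.
Qed.

(** The visit to [z] just before the final [x] is its last one, so a cut falls there and the final
    segment is a single step. *)
Lemma cut_last_step q z x : z != x ->
  exists s ss, cut (q ++ [:: z; x]) = s :: rcons ss [:: x].
Proof.
move=> zx; elim: q => [|y q [s [ss E]]] /=.
  by exists [:: z], [::]; rewrite inE (negPf zx).
rewrite E; case: ifP => _; first by exists (y :: s), ss.
by exists [:: y], (s :: ss).
Qed.

(** As [y] recurs, no cut is made at its first visit. *)
Lemma cut_head_size y p : y \in p -> 1 < size (head [::] (cut (y :: p))).
Proof.
move=> yp /=; rewrite yp.
case E: (cut p) => [|s ss]; first by rewrite (cut_nilP E) in yp.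
by case: s E => // E; have := cut_neq_nil p; rewrite E inE eqxx.
Qed.

Lemma walk_arcs_flatten x0 x ss : [::] \notin ss ->
  walk_arcs x (flatten ss) =
  flatten [seq walk_arcs w.1 w.2 | w <- zip (belast x (map (last x0) ss)) ss].
Proof.
elim: ss x => //= s ss IHS x; rewrite inE negb_or => /andP[s0 nS].
rewrite walk_arcs_cat -IHS //.
by case: s s0.
Qed.

(** The segment ending at [v] is [sg v]; it starts at [pv v], the end of the preceding segment, or
    the base [y] for the first one. *)
Lemma tour_segments y z p q : p = q ++ [:: z; y] -> z != y ->
    head y p \in behead p ->
  let U := undup p in exists (pv : T -> T) (sg : T -> seq T),
  [/\ flatten [seq walk_arcs (pv v) (sg v) | v <- U] = walk_arcs y p,
      forall v, v \in U ->
        [/\ pv v = nth y (y :: U) (index v U), last (pv v) (sg v) = v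
          & 0 < size (sg v)],
      forall v, v \in U -> (index v U).+1 = size U -> size (sg v) = 1,
      forall v, v \in U -> index v U = 0 -> 1 < size (sg v) &
      1 < size U].
Proof.
move=> pE zy hp U.
pose pv v := nth y (y :: U) (index v U).
pose sg v := nth [::] (cut p) (index v U).
have [s [ss E]] := cut_last_step q zy; rewrite -pE in E.
have szU : size U = (size ss).+2 by rewrite -size_cut E /= size_rcons.
have sg0 v : v \in U -> sg v \in cut p.
  by move=> vU; rewrite mem_nth // size_cut index_mem.
exists pv, sg; split=> [|v vU|v vU iv|v vU iv|]; last by rewrite szU.
- rewrite -[in RHS](flatten_cut p) (walk_arcs_flatten y y (cut_neq_nil p)).
  rewrite last_cut.
  congr flatten; apply: (@eq_from_nth _ [::]) => [|i].
    by rewrite !size_map size_zip size_cut size_belast minnn.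
  rewrite size_map => ltiU.
  rewrite (nth_map y) // (nth_map (y, [::])); last first.
    by rewrite size_zip size_cut size_belast minnn.
  rewrite nth_zip ?size_cut ?size_belast //= /pv /sg.
  rewrite index_uniq ?undup_uniq //; congr walk_arcs.
  by rewrite lastI nth_rcons size_belast ltiU.
- split=> //.
    have -> : last (pv v) (sg v) = last y (sg v).
      by case: (sg v) (sg0 v vU) (cut_neq_nil p) => // ->.
    rewrite -(nth_map _ y) ?last_cut ?size_cut ?index_mem //.
    by rewrite -/U nth_index.
  by case: (sg v) (sg0 v vU) (cut_neq_nil p) => // ->.
- rewrite /sg (_ : index v U = (size ss).+1); last by rewrite szU in iv; lia.
  by rewrite E /= nth_rcons ltnn eqxx.
- rewrite /sg iv; case: (p) hp => //= y' p' hp'.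
  by rewrite nth0; apply: (@cut_head_size y' p').
Qed.

End Cut.

(** * Segments of one component and of the whole graph *)

Section Segments.
Variables (T : finType) (e : rel T) (d : nat).
Hypotheses (esym : symmetric e) (eirr : irreflexive e).
Hypotheses (ereg : regular e (2 * d)) (hd : 2 <= d).

Lemma component_segments r : exists (U : seq T) (pv : T -> T) (sg : T -> seq T),
  [/\ [/\ uniq U, U =i connect e r & 1 < size U],
      forall a, \sum_(v <- U) count_mem a (und (walk_arcs (pv v) (sg v))) =
                (connect e r a.1 && e a.1 a.2),
      forall v, v \in U ->
        [/\ pv v = nth v U (if index v U is i.+1 then i else (size U).-1),
            last (pv v) (sg v) = v & 0 < size (sg v)],
      forall v, v \in U -> (index v U).+1 = size U -> size (sg v) = 1 &
      forall v, v \in U -> index v U = 0 -> 1 < size (sg v)].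
Proof.
have evd v : ~~ odd #|[set w | e v w]| by rewrite ereg; lia.
have [y [p [cry yp lp cE]]] := euler_tour esym eirr r evd.
have deg v : connect e r v ->
    count_mem v (belast y p) + count_mem v p = 2 * d.
  move=> crv; rewrite -(ereg v) -(@count_und_degree _ e v (walk_arcs y p)).
    by rewrite count_tail_und walk_arcs_tails walk_arcs_heads.
  by move=> a av; rewrite cE av crv.
have py : y \in p.
  case: (p) lp (deg y cry) => [|z p' /= <- _]; first by rewrite /=; lia.
  exact: mem_last.
have mp v : (v \in p) = connect e r v.
  apply/idP/idP => [vp|crv].
    apply: connect_trans cry _; apply: (path_connect yp).
    by rewrite inE vp orbT.
  have := deg v crv; apply: contra_eqT => vp.
  have : v \notin belast y p.
    apply: contra vp => /mem_belast; rewrite inE => /predU1P[->|] //.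
  by move: vp; rewrite -!has_pred1 !has_count; lia.
have [z [q [pE zy]]] : exists z q, p = q ++ [:: z; y] /\ z != y.
  move: lp yp; case/lastP: (p) py => // p' x' _; rewrite last_rcons => ->.
  case/lastP: p' => [|q z]; first by rewrite /= eirr.
  rewrite rcons_path last_rcons => /andP[_ ezy].
  exists z, q; split; first by rewrite -!cats1 -catA.
  by apply: contraTneq ezy => ->; rewrite eirr.
(* The first vertex after [y] differs from [y], so the tour enters it as often as it leaves it, that
   is [d >= 2] times; hence it recurs. *)
have hp : head y p \in behead p.
  case: (p) py lp yp mp deg => [|x p'] //= _ lp /andP[eyx _] mp deg.
  apply: contraT => xp'.
  have crx : connect e r x by rewrite -mp mem_head.
  have := deg x crx; have := count_belast x y (x :: p').
  have xy : (y == x) = false by apply: contraTF eyx => /eqP->; rewrite eirr.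
  rewrite /= lp xy eqxx; move: xp'; rewrite -has_pred1 has_count.
  by move: (count_mem x p') (count_mem x (belast x p')) => c1 c2; lia.
have [pv [sg [fE Uv Ul Uf sU]]] := tour_segments pE zy hp.
exists (undup p), pv, sg; split=> // [|a|v vU].
- by split; rewrite ?undup_uniq // => v; rewrite mem_undup mp.
- by rewrite -cE -fE count_und_flatten.
- have [pvE lv sv] := Uv v vU; split=> //; rewrite pvE.
  move: vU; rewrite -index_mem; case: index => [|i] ltU /=.
    (* The first segment starts at [y], which is also the last entry of [undup p] because the tour
       ends there. *)
    rewrite nth_last; have : last v (undup p) = last y (undup p).
      by case: (undup p) ltU.
    move->; rewrite -(last_cut y) pE.
    by have [s [ss ->]] := cut_last_step q zy; rewrite /= map_rcons last_rcons.
  exact: set_nth_default (ltnW ltU).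
Qed.

(** Components are represented by their roots. [J v] is the position of [v] in the cyclic order of
    its component, [N v] the order of that component, and [sg v] the segment with index [J v]. *)
Lemma graph_segments :
  exists (J N : T -> nat) (pv : T -> T) (sg : T -> seq T),
  [/\ [/\ forall v, J v < N v, forall v, 1 < N v,
          forall u v, fingraph.root e u = fingraph.root e v -> N u = N v
        & forall u v,
            fingraph.root e u = fingraph.root e v -> J u = J v -> u = v],
      forall a, \sum_v count_mem a (und (walk_arcs (pv v) (sg v))) =
                e a.1 a.2,
      forall v, [/\ fingraph.root e (pv v) = fingraph.root e v,
        J (pv v) = if J v is i.+1 then i else (N v).-1,
        last (pv v) (sg v) = v & 0 < size (sg v)],
      forall v, (J v).+1 = N v -> size (sg v) = 1 &
      forall v, J v = 0 -> 1 < size (sg v)].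
Proof.
have csym : connect_sym e by apply: sym_connect_sym.
have [U /fin_all_exists[pv /fin_all_exists[sg H]]] :=
  fin_all_exists component_segments.
pose V v := U (fingraph.root e v).
have VU v : v \in V v.
  have [[_ -> _] _ _ _ _] := H (fingraph.root e v).
  by rewrite inE csym connect_root.
exists (fun v => index v (V v)), (fun v => size (V v)),
  (fun v => pv (fingraph.root e v) v), (fun v => sg (fingraph.root e v) v).
split=> [|a|v|v|v].
- split=> [v|v|u v uv|u v uv].
  + by rewrite index_mem.
  + by case: (H (fingraph.root e v)) => [[]].
  + by rewrite /V uv.
  move=> iuv; have uV : u \in V v by rewrite /V -uv; apply: VU.
  by apply: index_inj uV (VU v) _; move: iuv; rewrite /V uv.
- have [[Uu Um _] Ua _ _ _] := H (fingraph.root e a.1).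
  rewrite (bigID (fun v => fingraph.root e v == fingraph.root e a.1)) /=.
  rewrite [X in _ + X]big1.
    rewrite addn0; have := Ua a; rewrite csym connect_root /= => <-.
    rewrite -big_filter; have pe : perm_eq
        [seq v <- index_enum T | fingraph.root e v == fingraph.root e a.1]
        (U (fingraph.root e a.1)).
      apply: uniq_perm => [|//|v].
        by rewrite filter_uniq ?index_enum_uniq.
      rewrite mem_filter mem_index_enum andbT Um inE -(root_connect csym).
      by rewrite (root_root csym) eq_sym.
    rewrite (perm_big _ pe) /=; apply: eq_big_seq => v.
    by rewrite Um inE -(root_connect csym) (root_root csym) => /eqP <-.
  (* In a component not containing the tail of [a], the multiplicities of [a] add up to 0, so each
     vanishes. *)
  move=> v vN; have [_ Va _ _ _] := H (fingraph.root e v).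
  have := Va a; rewrite -(root_connect csym) (root_root csym) (negPf vN) /=.
  rewrite (bigD1_seq v) //=; first by case: (count _ _).
  by case: (H (fingraph.root e v)) => [[]].
- have [[Uu Um sU] _ Up _ _] := H (fingraph.root e v).
  have [pvE lv sv] := Up v (VU v).
  have ltV :
      (if index v (V v) is i.+1 then i else (size (V v)).-1) < size (V v).
    have := VU v; rewrite -index_mem; case: index => [|i] ltV.
      by rewrite ltn_predL.
    exact: ltnW.
  have rE : fingraph.root e (pv (fingraph.root e v) v) = fingraph.root e v.
    have := mem_nth v ltV; rewrite -pvE Um inE -(root_connect csym).
    by rewrite (root_root csym) => /eqP.
  split=> //; rewrite /V rE -/(V v).
  by rewrite pvE index_uniq.
- by have [_ _ _ Ul _] := H (fingraph.root e v); apply: Ul.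
- by have [_ _ _ _ Uf] := H (fingraph.root e v); apply: Uf.
Qed.

End Segments.

(** * Vertex sums of a segment labelling *)

Section WeightedSum.
Variable T : eqType.
Implicit Types (v x : T) (p : seq T) (A : seq (T * T)).
Local Open Scope ring_scope.

Definition incidence v (a : T * T) : int := (a.2 == v)%:Z - (a.1 == v)%:Z.

(** The share of the arcs [A] in the vertex sum at [v] when they are labelled [m + 1], [m + 2], and
    so on. *)
Fixpoint weighted_sum m A v : int :=
  if A is a :: A' then m.+1%:Z * incidence v a + weighted_sum m.+1 A' v else 0.

Lemma weighted_sum_cat m A A' v :
  weighted_sum m (A ++ A') v =
  weighted_sum m A v + weighted_sum (m + size A)%N A' v.
Proof.
elim: A m => [|a A IHA] m /=; first by rewrite addn0 add0r.
by rewrite IHA addrA addSnnS.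
Qed.

(** The sum telescopes: an inner visit enters with one label and leaves with the next, contributing
    -1. The label [m + 1] leaving the start is split into [m] and a unit counted in [belast]. *)
Lemma weighted_sum_walk m x p v :
  weighted_sum m (walk_arcs x p) v =
  (m + size p)%:Z * (last x p == v)%:Z - m%:Z * (x == v)%:Z
  - (count_mem v (belast x p))%:Z.
Proof.
elim: p m x => [|y p IHp] m x /=; first by rewrite addn0 subrr.
rewrite IHp /incidence /= addnS addSn.
case: (last y p == v); case: (y == v); case: (x == v); lia.
Qed.

Lemma weighted_sum_index m A v : uniq A ->
  weighted_sum m A v =
  \sum_(a <- A) (m + (index a A).+1)%:Z * incidence v a.
Proof.
elim: A m => [|a A IHA] m /=; first by rewrite big_nil.
case/andP=> aA uA; rewrite big_cons eqxx addn1 IHA //; congr (_ + _).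
apply: eq_big_seq => b bA; case: eqP => [ab|_]; first by rewrite ab bA in aA.
by rewrite !addnS addSn.
Qed.

End WeightedSum.

(** * From an ordered family of walks to a labelled orientation *)

Section Labelling.
Variables (I T : finType) (e : rel T) (r : nat).
Variables (src : I -> T) (wk : I -> seq T) (key : I -> nat).
Hypotheses (ereg : regular e r) (keyI : injective key).
Let arcs_of i := walk_arcs (src i) (wk i).
Hypothesis count_arcs :
  forall a, \sum_i count_mem a (und (arcs_of i)) = e a.1 a.2.

(* The segment with key [q] receives the labels following [offset q]. *)
Definition offset q := \sum_(i | key i < q) size (wk i).

(** The walks are concatenated by increasing key and each arc is labelled by its position, so every
    walk gets an interval of labels. *)
Let O := sort (fun i j => key i <= key j) (enum I).
Let A := flatten (map arcs_of O).
Let D : rel T := fun x y => (x, y) \in A.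
Let L a := (index a A).+1.

Let permO : perm_eq O (index_enum I).
Proof. by rewrite /O perm_sort enumT. Qed.

Let count_A a : count_mem a A + count_mem (flip a) A = e a.1 a.2.
Proof.
by rewrite -count_und count_und_flatten (perm_big _ permO) count_arcs.
Qed.

Let uniqA : uniq A.
Proof.
apply: count_mem_uniq => a; have := count_A a; rewrite -has_pred1 has_count.
by move: (count_mem a A) (count_mem _ A) => c c'; case: (e _ _); lia.
Qed.

Lemma weighted_sum_sorted m s v : pairwise (fun i j => key i < key j) s ->
  weighted_sum m (flatten (map arcs_of s)) v =
  (\sum_(i <- s) weighted_sum
     (m + \sum_(j <- s | (key j < key i)%N) size (wk j))%N (arcs_of i) v)%R.
Proof.
elim: s m => [|i s IHs] m; first by rewrite big_nil.
rewrite pairwise_cons => /andP[/allP lts ps].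
rewrite /= big_cons weighted_sum_cat IHs // size_walk_arcs; congr (_ + _)%R.
  rewrite big_cons ltnn big_seq_cond big1 ?addn0 // => j /andP[/lts ltij].
  by rewrite ltnNge ltnW.
by apply: eq_big_seq => j /lts ltij; rewrite big_cons ltij addnA.
Qed.

Let vsumE v : vsum D L v = weighted_sum 0 A v.
Proof.
rewrite weighted_sum_index //.
rewrite (eq_bigr (fun a => (L a)%:Z * (a.2 == v)%:Z
                           - (L a)%:Z * (a.1 == v)%:Z)%R); last first.
  by move=> a _; rewrite -mulrBr.
rewrite sumrB; congr (_ - _)%R; rewrite big_uniq //=.
  rewrite (eq_bigr (fun a => if a.2 == v then (L a)%:Z else 0)%R); last first.
    by move=> a _; case: ifP; rewrite ?mulr1 ?mulr0.
  rewrite -big_mkcondr (reindex_onto (fun u => (u, v)) fst) /=; last first.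
    by case=> a1 a2 /andP[_ /eqP /= ->].
  by apply: eq_bigl => u; rewrite !eqxx !andbT.
rewrite (eq_bigr (fun a => if a.1 == v then (L a)%:Z else 0)%R); last first.
  by move=> a _; case: ifP; rewrite ?mulr1 ?mulr0.
rewrite -big_mkcondr (reindex_onto (fun u => (v, u)) snd) /=; last first.
  by case=> a1 a2 /andP[_ /eqP /= ->].
by apply: eq_bigl => u; rewrite !eqxx !andbT.
Qed.

Lemma pairwise_O : pairwise (fun i j => key i < key j) O.
Proof.
have tot : total (fun i j => key i <= key j) by move=> i j; apply: leq_total.
have tr : transitive (fun i j => key i <= key j).
  by move=> i j k; apply: leq_trans.
have := sort_sorted tot (enum I); rewrite -/O sorted_pairwise //.
have : uniq O by rewrite /O sort_uniq enum_uniq.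
elim: O => //= i s IHs /andP[is_ us] /andP[/allP le ps]; rewrite IHs // andbT.
apply/allP => j js; rewrite ltn_neqAle le // andbT.
by apply: contra is_ => /eqP/keyI ->.
Qed.

(** Here [out v] is the out-degree. In-degree and out-degree add up to [r], and their difference is
    the number of walks ending at [v] minus the number starting there. *)
Lemma segment_labelling :
  exists (D : rel T) (L : T * T -> nat) (out : T -> nat),
  [/\ orientation e D, {in arcs D &, injective L},
      forall a, a \in arcs D -> 1 <= L a <= #|arcs D|,
      forall v, 2 * out v + \sum_i (last (src i) (wk i) == v) =
                r + \sum_i (src i == v)
    & forall v, (vsum D L v =
        \sum_i ((offset (key i) + size (wk i))%:Z
                  * (last (src i) (wk i) == v)%:Z
                - (offset (key i))%:Z * (src i == v)%:Z) - (out v)%:Z)%R].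
Proof.
have AD : arcs D =i A by case=> x y; rewrite inE.
have cardA : #|arcs D| = size A by rewrite (eq_card AD); apply/card_uniqP.
exists D, L, (fun v => \sum_i count_mem v (belast (src i) (wk i))).
split=> [|a b|a|v|v].
- split=> x y.
    rewrite /D -has_pred1 has_count; have := count_A (x, y) => /=.
    by move: (count_mem _ A) (count_mem _ A) => c c'; case: (e _ _); lia.
  move=> exy; have := count_A (x, y); rewrite /= exy /D.
  by rewrite !(count_uniq_mem _ uniqA); do 2 case: (_ \in _).
- rewrite !AD => aA bA [iab]; exact: index_inj iab.
- by rewrite AD cardA => aA; rewrite /L /= index_mem.
- have degE : count (fun a => a.1 == v) (und A) = r.
    rewrite -(ereg v); apply: count_und_degree => a _.
    by rewrite count_und count_A.
  have -> : r = \sum_i (count_mem v (belast (src i) (wk i))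
                        + count_mem v (wk i)).
    rewrite -degE count_tail_und !count_map -(perm_big _ permO) /= /A.
    elim: O => [|i s IHs]; first by rewrite big_nil.
    rewrite big_cons -IHs /= !count_cat -!count_map.
    by rewrite walk_arcs_tails walk_arcs_heads !count_map /= ; lia.
  rewrite big_distrr /= -!big_split /=; apply: eq_bigr => i _.
  have := count_belast v (src i) (wk i).
  move: (count_mem v (wk i)) (count_mem v (belast _ _)) => c c'.
  by case: (_ == v); case: (_ == v); lia.
transitivity (weighted_sum 0 A v); first exact: vsumE.
rewrite weighted_sum_sorted ?pairwise_O //.
rewrite (perm_big _ permO) /= (big_morph Posz PoszD (erefl (Posz 0))) -sumrB.
apply: eq_bigr => i _; rewrite weighted_sum_walk add0n.
by rewrite (perm_big _ permO).
Qed.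

End Labelling.

(** * The order of the segments *)

Section Keys.
Variable K : nat.
Implicit Types (i j n : nat).

(* Rank of the segment [f_j] of the [i]-th component, which has [n] vertices;
   [B] is its level in the zigzag order and [s] its side.  Level [0] of the odd
   components is split by side, which makes the sums at the base points
   distinct.  The shift [2 * K * K] exceeds all keys of odd components. *)
Definition seg_key i n j :=
  let B := minn j (n.-1 - j) in let s := (n.-1 - j < j) : nat in
  if odd n then if B == 0 then s * K + i else 2 * (B * K + i) + s
  else 2 * (K * K) + i * K + (2 * B + s).

Definition next_index n j := if j.+1 == n then 0 else j.+1.

Lemma mul_gap (B B' : nat) : B < B' -> B * K + K <= B' * K.
Proof. by move=> ltB; rewrite -mulSnr leq_mul2r ltB orbT. Qed.

(** Trichotomy in a form that lets [lia] treat the products with [K] as atoms. *)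
Lemma mul_cases (B B' : nat) :
  [\/ B * K + K <= B' * K, B = B' | B' * K + K <= B * K].
Proof.
have [ltB|ltB|eB] := ltngtP B B'.
- by constructor 1; apply: mul_gap.
- by constructor 3; apply: mul_gap.
- by constructor 2.
Qed.

(** [B] is the level and [s] the side; [2 * B + s < n] puts the middle position of an odd component
    on side [false] only. The bounds on [B * K] are recorded for linear arithmetic. *)
Variant seg_key_spec i n j : nat -> Prop :=
| SegKeyFirst of odd n & j = 0 : seg_key_spec i n j i
| SegKeyLast of odd n & j.+1 = n : seg_key_spec i n j (K + i)
| SegKeyMid B (s : bool) of odd n & K <= B * K & B * K + K <= K * K
    & 0 < B & j = (if s then n.-1 - B else B) & 2 * B + s < n :
    seg_key_spec i n j (2 * (B * K + i) + s)
| SegKeyEven B (s : bool) of ~~ odd n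
    & j = (if s then n.-1 - B else B) & 2 * B + s < n :
    seg_key_spec i n j (2 * (K * K) + i * K + (2 * B + s)).

Lemma seg_keyP i n j :
  1 < n -> n <= K -> j < n -> seg_key_spec i n j (seg_key i n j).
Proof.
move=> n1 nK jn; rewrite /seg_key; have [on|on] := boolP (odd n).
  have [j0|j0] := posnP j.
    by rewrite j0 min0n /=; constructor.
  have [jl|jl] := eqVneq j.+1 n.
    rewrite (_ : n.-1 - j = 0) ?minn0 /=; last by lia.
    by rewrite j0 mul1n; constructor.
  have [hj|hj] := leqP j (n.-1 - j).
    rewrite eqn0Ngt j0 /=; apply: (@SegKeyMid _ _ _ _ false) => //; try lia.
      by apply: leq_pmull.
    by apply: mul_gap; lia.
  rewrite /= ifN; last by lia.
  apply: (@SegKeyMid _ _ _ _ true) => //; try lia.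
    by apply: leq_pmull; lia.
  by apply: mul_gap; lia.
have [hj|hj] := leqP j (n.-1 - j).
  by apply: (@SegKeyEven _ _ _ _ false) => //; lia.
by apply: (@SegKeyEven _ _ _ _ true) => //; lia.
Qed.

(** Level 0 of the odd components occupies [[0, 2K)], their other levels [[2K, 2K^2)]; even
    components lie above, in disjoint blocks of length [K]. *)
Lemma seg_key_inj i n j i' n' j' :
    1 < n <= K -> 1 < n' <= K -> i < K -> i' < K -> j < n -> j' < n' ->
    (i = i' -> n = n') -> seg_key i n j = seg_key i' n' j' ->
  i = i' /\ j = j'.
Proof.
move=> /andP[n1 nK] /andP[n1' nK'] iK iK' jn jn' ii.
have Ki := mul_cases i i'.
have KK : K <= K * K by apply: leq_pmull; lia.
case: seg_keyP => // [on j0|on jl|B s on KB BK B0 Bj Bn|B s on Bj Bn];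
  case: seg_keyP => // [on' j0'|on' jl'|B' s' on' KB' BK' B0' Bj' Bn'
                       |B' s' on' Bj' Bn'] E; try by split; lia.
  by have [H|H|H] := mul_cases B B'; split;
    case: (s) (s') Bj Bj' E => [] []; lia.
by case: Ki => H; split; case: (s) (s') Bj Bj' Bn Bn' E => [] []; lia.
Qed.

Definition same_pair (a b lo hi : nat) :=
  (a = lo /\ b = hi) \/ (a = hi /\ b = lo).

Lemma odd_node_keys i n j : odd n -> n <= K -> j.+1 < n ->
  exists m (s t : bool), [/\ t <= s, j = (if s then n - 2 - m else m),
    2 * m + s < n.-1 &
    same_pair (seg_key i n j) (seg_key i n j.+1)
      (if m == 0 then (if s then K + i else i) else 2 * (m * K + i) + s)
      (2 * (m * K + K + i) + t)].
Proof.
move=> on nK jn; rewrite /same_pair.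
have [hj|hj] := ltnP (2 * j) n.-1.
  exists j, false, false; split=> //; first by rewrite addn0.
  left; split.
    case: seg_keyP => //; try lia.
      by move=> _ ->.
    move=> B [] _ _ _ B0 Bj Bn; first lia.
    by rewrite Bj eqn0Ngt B0.
  case: seg_keyP => //; try lia.
  move=> B [] _ _ _ B0 Bj Bn; first lia.
  by rewrite -Bj (mulSnr j).
have [m mE] : exists m, m = n - 2 - j by exists (n - 2 - j).
have bnd : 2 * m + true < n.-1 by rewrite /=; lia.
exists m, true, (n.-1 < 2 * j); split=> //; [by case: (_ < _)|lia|].
right; split.
  case: seg_keyP => //; try lia.
  move=> B s _ _ _ B0 Bj Bn; rewrite -(mulSnr m) (_ : B = m.+1); last first.
    by case: s Bj Bn; lia.
  by congr (_ + nat_of_bool _); case: s Bj Bn; lia.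
case: seg_keyP => //; try lia.
  move=> _ jl; rewrite (_ : m = 0) //; lia.
move=> B s _ _ _ B0 Bj Bn; rewrite (_ : B = m); last first.
  by case: s Bj Bn; lia.
rewrite ifN; last by case: s Bj Bn; lia.
by congr (_ + nat_of_bool _); case: s Bj Bn; lia.
Qed.

(** The componentwise order on unordered pairs, made strict through the sums. *)
Definition dominated (a b a' b' : nat) :=
  (a + b < a' + b') && (((a <= a') && (b <= b')) || ((a <= b') && (b <= a'))).

Lemma dominated_pairs a b lo hi a' b' lo' hi' :
    same_pair a b lo hi -> same_pair a' b' lo' hi' ->
    [/\ lo <= lo', hi <= hi' & lo + hi < lo' + hi'] \/
    [/\ lo' <= lo, hi' <= hi & lo' + hi' < lo + hi] ->
  dominated a b a' b' || dominated a' b' a b.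
Proof.
rewrite /dominated => H H' [[h1 h2 h3]|[h1 h2 h3]]; apply/orP; [left|right];
by case: H => -[-> ->]; case: H' => -[-> ->]; lia.
Qed.

(** Pairs are compared by level, then component, then side. Level 0 is instead ordered by side
    before component, which would conflict with the order on level 1 if the sides could differ
    there. *)
Lemma odd_pairs_comparable i i' m m' (s t s' t' : bool) :
    i < K -> i' < K -> t <= s -> t' <= s' -> (m = m' -> i = i' -> s != s') ->
    (m = 0 -> m' = 0 -> s = s') ->
  let lo := if m == 0 then (if s then K + i else i) else 2 * (m * K + i) + s in
  let lo' := if m' == 0 then (if s' then K + i' else i')
             else 2 * (m' * K + i') + s' in
  let hi := 2 * (m * K + K + i) + t in
  let hi' := 2 * (m' * K + K + i') + t' in
  [/\ lo <= lo', hi <= hi' & lo + hi < lo' + hi'] \/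
  [/\ lo' <= lo, hi' <= hi & lo' + hi' < lo + hi].
Proof.
move=> iK iK' ts ts' ds s0 /=.
have mK (u : nat) : 0 < u -> K <= u * K by apply: leq_pmull.
have [ltm|ltm|eqm] := ltngtP m m'; last first.
- subst m'; have {}ds := ds (erefl m).
  have [m0|m0] := posnP m.
    rewrite m0 mul0n; have {}s0 := s0 m0 m0; subst s'.
    have [lti|lti|eqi] := ltngtP i i'; last by have := ds eqi; rewrite eqxx.
      by left; case: s ts ts' {ds} => ts ts'; clear mK; split; lia.
    by right; case: s ts ts' {ds} => ts ts'; clear mK; split; lia.
  move: (m * K) {s0 m0 mK} => P.
  have [lti|lti|eqi] := ltngtP i i'.
  + by left; clear ds; split; lia.
  + by right; clear ds; split; lia.
  + subst i'; have {ds} := ds (erefl i).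
    by case: s s' t t' ts ts' => [] [] [] [] // _ _ _;
      first [left; split; lia | right; split; lia].
- right; have := mul_gap ltm; have := mK m (leq_ltn_trans (leq0n _) ltm).
  rewrite (_ : (m == 0) = false) ?(gtn_eqF (leq_ltn_trans _ ltm)) //.
  have [m0|m0] := posnP m'; first rewrite m0 mul0n.
    move: (m * K) {ds s0 mK ltm m0} => P h1 h2.
    by case: s' ts' => ts'; split; lia.
  move: (m * K) (m' * K) {ds s0 mK ltm m0} => P P' h1 h2.
  by split; lia.
left; have := mul_gap ltm; have := mK m' (leq_ltn_trans (leq0n _) ltm).
rewrite (_ : (m' == 0) = false) ?(gtn_eqF (leq_ltn_trans _ ltm)) //.
have [m0|m0] := posnP m; first rewrite m0 mul0n.
  move: (m' * K) {ds s0 mK ltm m0} => P h1 h2.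
  by case: s ts => ts; split; lia.
move: (m * K) (m' * K) {ds s0 mK ltm m0} => P P' h1 h2.
by split; lia.
Qed.

(** The position [2 * B + s] of [f_j] in the zigzag order. *)
Definition fold_index n j := if 2 * j < n then 2 * j else 2 * (n.-1 - j) + 1.

Lemma seg_key_even i n j : ~~ odd n -> 1 < n -> n <= K -> j < n ->
  seg_key i n j = 2 * (K * K) + i * K + fold_index n j /\ fold_index n j < n.
Proof.
move=> on n1 nK jn; case: seg_keyP => //; try by rewrite (negPf on).
move=> B s _ jE Bn; have -> : fold_index n j = 2 * B + s; last by [].
rewrite /fold_index jE; case: s jE Bn => jE Bn; first by rewrite ifN /=; lia.
by rewrite ifT /=; lia.
Qed.

Lemma seg_key_even_bound i n j : ~~ odd n -> 1 < n -> n <= K -> j < n ->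
  2 * (K * K) <= seg_key i n j.
Proof.
by move=> on n1 nK jn; have [-> _] := seg_key_even i on n1 nK jn; lia.
Qed.

Lemma seg_key_odd_bound i n j : odd n -> 1 < n -> n <= K -> j < n -> i < K ->
  seg_key i n j < 2 * (K * K).
Proof.
move=> on n1 nK jn iK; have KK : 2 * K <= K * K by rewrite leq_mul2r; lia.
by case: seg_keyP => //; lia.
Qed.

Lemma next_index_lt n j : j < n -> next_index n j < n.
Proof. by rewrite /next_index; case: eqP; lia. Qed.

Lemma dominated_shift b x y x' y' :
  dominated (b + x) (b + y) (b + x') (b + y') = dominated x y x' y'.
Proof.
rewrite /dominated !leq_add2l; congr (_ && _).
by rewrite addnACA [b + x' + _]addnACA ltn_add2l.
Qed.

Lemma dominated_lt b x y x' y' :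
  x < b -> y < b -> b <= x' -> b <= y' -> dominated x y x' y'.
Proof. by rewrite /dominated => *; lia. Qed.

(** Cyclically consecutive segments are two apart in the zigzag order, except at its two ends, where
    they are adjacent. *)
Lemma fold_index_comparable n j j' : ~~ odd n -> 1 < n -> j < n -> j' < n ->
    odd j = odd j' -> j != j' ->
  dominated (fold_index n j) (fold_index n (next_index n j))
            (fold_index n j') (fold_index n (next_index n j')) ||
  dominated (fold_index n j') (fold_index n (next_index n j'))
            (fold_index n j) (fold_index n (next_index n j)).
Proof.
move=> on n1 jn jn' par neq; set c := fold_index n; set s := next_index n.
pose P u lo hi := [\/ lo = 2 * u /\ hi = 2 * u + 2 /\ 2 * u + 2 < n,
  lo = 2 * u /\ hi = 2 * u + 1 /\ 2 * u + 2 = n |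
  lo = 2 * (n.-1 - u) - 1 /\ hi = 2 * (n.-1 - u) + 1 /\ n <= 2 * u].
have node u : u < n ->
    exists lo hi, same_pair (c u) (c (s u)) lo hi /\ P u lo hi.
  move=> un; rewrite /c /s /fold_index /next_index /P /same_pair.
  have [h|h|h] := ltngtP (2 * u + 2) n.
  - exists (2 * u), (2 * u + 2); split; last by constructor 1.
    left; rewrite ifT; last by lia.
    by rewrite (_ : (u.+1 == n) = false) ?ifT; lia.
  - have [e|e] := eqVneq u.+1 n.
      (* At the closing node [u = n - 1] truncated subtraction turns the lower position into 0, as
         required for the pair of [f_(n-1)] and [f_0]. *)
      exists 0, 1; split; last by constructor 3; lia.
      by right; rewrite ifN; [rewrite ifT|]; lia.
    exists (2 * (n.-1 - u) - 1), (2 * (n.-1 - u) + 1).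
    split; last by constructor 3; lia.
    by right; rewrite ifN ?ifN; lia.
  exists (2 * u), (2 * u + 1); split; last by constructor 2.
  left; rewrite ifT; last by lia.
  have [e|e] := eqVneq u.+1 n; first by lia.
  by rewrite ifN; lia.
have [lo [hi [H C]]] := node j jn; have [lo' [hi' [H' C']]] := node j' jn'.
apply: dominated_pairs H H' _; clear node c s; rewrite {}/P in C C'.
have D : lo <= lo' /\ hi <= hi' /\ lo + hi < lo' + hi' \/
         lo' <= lo /\ hi' <= hi /\ lo' + hi' < lo + hi.
  by case: C => -[h1 [h2 h3]]; case: C' => -[h1' [h2' h3']]; lia.
by case: D => -[? [? ?]]; [left|right].
Qed.

Lemma seg_key_comparable i n j i' n' j' :
    1 < n <= K -> 1 < n' <= K -> i < K -> i' < K -> j < n -> j' < n' ->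
    (i = i' -> n = n') -> ~ (i = i' /\ j = j') -> odd j = odd j' ->
    ~~ (odd n && (j.+1 == n)) -> ~~ (odd n' && (j'.+1 == n')) ->
  dominated (seg_key i n j) (seg_key i n (next_index n j))
            (seg_key i' n' j') (seg_key i' n' (next_index n' j')) ||
  dominated (seg_key i' n' j') (seg_key i' n' (next_index n' j'))
            (seg_key i n j) (seg_key i n (next_index n j)).
Proof.
move=> /andP[n1 nK] /andP[n1' nK'] iK iK' ltj ltj' ii neq par nj nj'.
have KK : K <= K * K by apply: leq_pmull; lia.
set jn := next_index n j; set jn' := next_index n' j'.
have Ki := mul_cases i i'.
have ltjn : jn < n by apply: next_index_lt.
have ltjn' : jn' < n' by apply: next_index_lt.
have [on|on] := boolP (odd n); have [on'|on'] := boolP (odd n').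
- rewrite /jn /jn' /next_index !ifN; [|lia|lia].
  have [|m [s [t [ts jE mn H]]]] := @odd_node_keys i n j on nK; first by lia.
  have [|m' [s' [t' [ts' jE' mn' H']]]] := @odd_node_keys i' n' j' on' nK'.
    by lia.
  apply: dominated_pairs H H' (odd_pairs_comparable _ _ _ _ _ _) => //.
    move=> em ei; move: neq; rewrite jE jE' em (ii ei) ei.
    by case: (s) (s') => [] [] //= [].
  (* On level 0, side [false] means [j = 0] and side [true] means [j = n - 2], which is odd; equal
     parity forces equal sides. *)
  by move=> m0 m0'; clear Ki KK ii neq nj nj' nK nK'; subst m m';
    case: s s' jE jE' {mn mn' ts ts'} => [] []; lia.
- apply/orP; left; apply: (@dominated_lt (2 * (K * K)));
    by rewrite ?seg_key_odd_bound ?seg_key_even_bound.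
- apply/orP; right; apply: (@dominated_lt (2 * (K * K)));
    by rewrite ?seg_key_odd_bound ?seg_key_even_bound.
have [-> f1] := seg_key_even i on n1 nK ltj.
have [-> f2] := seg_key_even i on n1 nK ltjn.
have [-> f1'] := seg_key_even i' on' n1' nK' ltj'.
have [-> f2'] := seg_key_even i' on' n1' nK' ltjn'.
case: Ki => [lti|eqi|lti].
- apply/orP; left; apply: (@dominated_lt (2 * (K * K) + i' * K)); lia.
- move: neq (ii eqi); rewrite /jn /jn' -eqi => neq nn; subst n'.
  rewrite !dominated_shift; apply: fold_index_comparable => //.
  by apply/eqP => jj; apply: neq.
- apply/orP; right; apply: (@dominated_lt (2 * (K * K) + i * K)); lia.
Qed.

End Keys.

(** * Distinctness of the vertex sums *)

Section DistinctSums.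
Variables (T : finType) (K : nat).
Variables (cid J N len : T -> nat) (nx : T -> T).
Hypotheses (cidK : forall v, cid v < K) (NK : forall v, 1 < N v <= K).
Hypotheses (JN : forall v, J v < N v).
Hypothesis cidN : forall u v, cid u = cid v -> N u = N v.
Hypothesis cidJ : forall u v, cid u = cid v -> J u = J v -> u = v.
Hypotheses (nxC : forall v, cid (nx v) = cid v) (nxI : injective nx).
Hypothesis nxJ : forall v, J (nx v) = next_index (N v) (J v).
Hypothesis len_gt0 : forall v, 0 < len v.
Hypothesis len_last : forall v, (J v).+1 = N v -> len v = 1.
Hypothesis len_first : forall v, J v = 0 -> 1 < len v.

Let key v := seg_key K (cid v) (N v) (J v).
(** The segment ending at [v] carries the labels from [off (key v) + 1] to [top v]. *)
Let off q := \sum_(u | key u < q) len u.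
Let top v := off (key v) + len v.

Lemma seg_key_vertex_inj : injective key.
Proof.
move=> u v kuv; have := @seg_key_inj K _ _ _ _ _ _ (NK u) (NK v) (cidK u)
  (cidK v) (JN u) (JN v) (@cidN u v) kuv.
by case; apply: cidJ.
Qed.

Let Nnx v : N (nx v) = N v.
Proof. exact: cidN (nxC v). Qed.

Let off_next v : off (key v).+1 = top v.
Proof.
rewrite /top addnC /off (bigD1 v) //=; congr (_ + _); apply: eq_bigl => u.
by rewrite ltnS [in RHS]ltn_neqAle (inj_eq seg_key_vertex_inj) andbC.
Qed.

Let off_mono q q' : q <= q' -> off q <= off q'.
Proof.
move=> qq'; rewrite /off !(big_mkcond (fun u => _ < _)) leq_sum // => u _.
by case: ifP => // uq; rewrite ifT // (leq_trans uq).
Qed.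

Let top_le u v : key u < key v -> top u <= off (key v).
Proof. by rewrite -off_next; apply: off_mono. Qed.

Lemma dominated_sum_lt (F : T -> nat) u u' w w' :
    (forall x y, key x < key y -> F x < F y) ->
    dominated (key u) (key u') (key w) (key w') ->
  F u + F u' < F w + F w'.
Proof.
move=> Flt; have Fle x y : key x <= key y -> F x <= F y.
  by rewrite leq_eqVlt => /predU1P[/seg_key_vertex_inj ->|/Flt/ltnW].
have case_lt x x' y y' : key x + key x' < key y + key y' ->
    key x <= key y -> key x' <= key y' -> F x + F x' < F y + F y'.
  move=> lts lex lex'; have [e|ltx] := eqVneq (key x) (key y).
    have /Flt ltx' : key x' < key y' by move: lts; rewrite e ltn_add2l.
    by rewrite -addnS leq_add // Fle.
  by rewrite -addSn leq_add // ?Fle // Flt // ltn_neqAle ltx.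
case/andP=> lts /orP[/andP[h1 h2]|/andP[h1 h2]]; first exact: case_lt.
by rewrite [F w + _]addnC; apply: case_lt => //; rewrite [key w' + _]addnC.
Qed.

Let KK (v : T) : K <= K * K.
Proof. by apply: leq_pmull; apply: leq_ltn_trans (cidK v). Qed.

Let key_first v : odd (N v) -> J v = 0 -> key v = cid v.
Proof.
have /andP[n1 nK] := NK v; move=> oN j0; rewrite /key.
case: seg_keyP => //; [lia| |by rewrite oN].
by move=> B [] _ _ _ B0 Bj Bn; lia.
Qed.

Let key_last v : odd (N v) -> (J v).+1 = N v -> key v = K + cid v.
Proof.
have /andP[n1 nK] := NK v; move=> oN jl; rewrite /key.
case: seg_keyP => //; [lia| |by rewrite oN].
by move=> B [] _ _ _ B0 Bj Bn; lia.
Qed.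

Let key_small v : key v < 2 * K ->
  odd (N v) /\ (if key v < K then J v = 0 else (J v).+1 = N v).
Proof.
have /andP[n1 nK] := NK v; have iK := cidK v; have := KK v; rewrite /key.
case: seg_keyP => //.
- by rewrite iK.
- by move=> -> jl _ _; rewrite ltnNge leq_addr.
- by move=> B s; lia.
by move=> B s; lia.
Qed.

(** Either condition makes [u] the base point of an odd component: its segment is the last one, and
    that of [nx u] the first. *)
Let key_shift u : (key (nx u) < K) || (K <= key u < 2 * K) ->
  key u = K + key (nx u).
Proof.
case/orP=> [kn|/andP[ku1 ku2]].
  have [|oN] := @key_small (nx u); first by lia.
  rewrite kn nxJ /next_index; case: eqP => // jl _.
  rewrite Nnx in oN; rewrite key_last // key_first ?Nnx ?nxC //.
  by rewrite nxJ /next_index jl eqxx.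
have [oN] := key_small ku2; rewrite ltnNge ku1 /= => jl.
by rewrite key_last // key_first ?Nnx ?nxC // nxJ /next_index jl eqxx.
Qed.

Let cnt q := \sum_u (key u < q).

(** Keys from [K] up to [2 * K] belong to last segments, of one edge each; reindexing by [nx] pairs
    each with the first segment of its component. *)
Let off_shift q : q <= K -> off (K + q) = off K + cnt q.
Proof.
move=> qK; rewrite /cnt (reindex_inj nxI) /off.
rewrite !(big_mkcond (fun u => _ < _)) /=.
rewrite -big_split; apply: eq_bigr => u _ /=.
have shift := @key_shift u.
have [ku|ku] := ltnP (key u) K.
  rewrite ifT; last by lia.
  case: (ltnP (key (nx u)) q) => h; last by rewrite addn0.
  by have := shift; rewrite (leq_trans h qK); lia.
have [ku2|ku2] := ltnP (key u) (2 * K).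
  have {}shift : key u = K + key (nx u) by apply: shift; rewrite ku ku2 orbT.
  have [oN] := key_small ku2; rewrite ltnNge ku /= => /len_last ->.
  by rewrite shift ltn_add2l; case: ifP.
rewrite ifN; last by lia.
case: (ltnP (key (nx u)) q) => // h.
by have := shift; rewrite (leq_trans h qK); lia.
Qed.

(** Keys below [K] belong to first segments, of at least two edges, so [off] grows at least twice as
    fast as [cnt]. *)
Let off_cnt q q' : q <= q' -> q' <= K ->
  off q + 2 * cnt q' <= off q' + 2 * cnt q.
Proof.
move=> qq' q'K; rewrite /off /cnt !(big_mkcond (fun u => _ < _)) /=.
rewrite !big_distrr /=.
rewrite -!big_split; apply: leq_sum => u _ /=.
case: (ltnP (key u) q) => h; first by rewrite (leq_trans h qq'); lia.
case: (ltnP (key u) q') => h' //.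
have [|_] := @key_small u; first by lia.
by rewrite (leq_trans h' q'K) => /len_first; lia.
Qed.

(* The vertex sum increased by half the degree; the last case is the base point
   of a component of odd order. *)
Definition shifted_sum v : int :=
  (if odd (J v) then - ((off (key v) + off (key (nx v))).+1)%:Z
   else if odd (J (nx v)) then (top v + top (nx v)).+1%:Z
   else (top v)%:Z - (off (key (nx v)))%:Z)%R.

Let jumpP v : ~~ odd (J v) -> ~~ odd (J (nx v)) ->
  odd (N v) /\ (J v).+1 = N v.
Proof. by rewrite nxJ /next_index; case: eqP => //=; lia. Qed.

Let jump_key v : ~~ odd (J v) -> ~~ odd (J (nx v)) ->
  key v = K + cid v /\ key (nx v) = cid v.
Proof.
move=> h1 h2; have [oN jl] := jumpP h1 h2.
rewrite key_last // key_first ?Nnx ?nxC //.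
by rewrite nxJ /next_index jl eqxx.
Qed.

Let node_comparable u v : u != v -> odd (J u) = odd (J v) ->
    odd (J u) || odd (J (nx u)) -> odd (J v) || odd (J (nx v)) ->
  dominated (key u) (key (nx u)) (key v) (key (nx v)) ||
  dominated (key v) (key (nx v)) (key u) (key (nx u)).
Proof.
move=> uv par hu hv; rewrite /key !nxJ !Nnx !nxC.
have nj w : odd (J w) || odd (J (nx w)) -> ~~ (odd (N w) && ((J w).+1 == N w)).
  rewrite nxJ /next_index; case: eqP => [jl|_]; last by rewrite andbF.
  by rewrite -jl /= andbT orbF => ->.
apply: seg_key_comparable; rewrite ?NK ?cidK ?JN ?nj //; first exact: cidN.
by case=> cc jj; rewrite (cidJ cc jj) eqxx in uv.
Qed.

(** Sources have negative sums, base points positive ones, and sinks still larger ones. Two sinks,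
    or two sources, have comparable pairs of keys. *)
Lemma shifted_sum_inj : injective shifted_sum.
Proof.
have lt_top x y : key x < key y -> top x < top y.
  by move=> /top_le h; rewrite /top; have := len_gt0 y; rewrite /top in h; lia.
have lt_off x y : key x < key y -> off (key x) < off (key y).
  by move=> /top_le; have := len_gt0 x; rewrite /top; lia.
have jump_pos v : ~~ odd (J v) -> ~~ odd (J (nx v)) ->
    off (key (nx v)) < top v.
  move=> h1 h2; have [k1 k2] := jump_key h1 h2.
  have /top_le : key (nx v) < key v by have := cidK v; lia.
  by have := len_gt0 v; have := len_gt0 (nx v); rewrite /top; lia.
have sink_jump u v : ~~ odd (J u) -> odd (J (nx u)) ->
    ~~ odd (J v) -> ~~ odd (J (nx v)) -> top v < top u + top (nx u).
  move=> u1 u2 v1 v2; have [k1 _] := jump_key v1 v2; have vK := cidK v.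
  (* Keys below [2 * K] belong to even positions of odd components, whereas [nx u] has odd
     position. *)
  have [h|h] := ltnP (key v) (key (nx u)); first by have := lt_top _ _ h; lia.
  have [|oN] := @key_small (nx u); first by lia.
  case: ifP => _ j; first by rewrite j in u2.
  by move: oN; rewrite -j /= u2.
have jump_neq u v : ~~ odd (J u) -> ~~ odd (J (nx u)) ->
    ~~ odd (J v) -> ~~ odd (J (nx v)) -> cid u < cid v ->
    top v + off (key (nx u)) < top u + off (key (nx v)).
  move=> u1 u2 v1 v2 uv.
  have [ku ku'] := jump_key u1 u2; have [kv kv'] := jump_key v1 v2.
  have topE w : key w = K + cid w -> key (nx w) = cid w ->
      top w = off K + (cnt (cid w)).+1.
    move=> h h'; rewrite -off_next h -addnS off_shift //; congr (_ + _).
    rewrite /cnt (bigD1 (nx w)) //= h' ltnSn add1n; congr _.+1.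
    rewrite [in RHS](bigD1 (nx w)) //= h' ltnn add0n; apply: eq_bigr => x.
    rewrite -(inj_eq seg_key_vertex_inj) h' ltnS => xw.
    by rewrite [in RHS]ltn_neqAle xw.
  have cnt_lt : cnt (cid u) < cnt (cid v).
    rewrite /cnt (bigD1 (nx u)) // [in X in _ < X](bigD1 (nx u)) //=.
    rewrite ku' ltnn uv.
    rewrite add0n add1n ltnS; apply: leq_sum => x _.
    by case: ltnP => // h; rewrite (ltn_trans h uv).
  (* From [u] to [v] the top label rises by the increase of [cnt], but the offset subtracted from it
     rises at least twice as much. *)
  rewrite (topE u) // (topE v) // ku' kv'.
  by have := off_cnt (ltnW uv) (ltnW (cidK v)); lia.
move=> u v; rewrite /shifted_sum => E; apply/eqP; apply: contraT => uv.
have comp := @node_comparable u v uv.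
have offF := @dominated_sum_lt (fun w => off (key w)) _ _ _ _ lt_off.
have topF := @dominated_sum_lt top _ _ _ _ lt_top.
case: (boolP (odd (J u))) E comp => u1; case: (boolP (odd (J v))) => v1 /= E.
- by case/(_ erefl isT isT)/orP=> /offF /=; lia.
- move=> _; case: (boolP (odd _)) E => v2; first by lia.
  by have := jump_pos v v1 v2; lia.
- move=> _; case: (boolP (odd _)) E => u2; first by lia.
  by have := jump_pos u u1 u2; lia.
case: (boolP (odd _)) E => u2; case: (boolP (odd _)) => v2 E.
- by case/(_ erefl isT isT)/orP=> /topF; lia.
- by have := sink_jump u v u1 u2 v1 v2; lia.
- by have := sink_jump v u v1 v2 u1 u2; lia.
move=> _; have [c|c|c] := ltngtP (cid u) (cid v).
- by have := jump_neq u v u1 u2 v1 v2 c; lia.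
- by have := jump_neq v u v1 v2 u1 u2 c; lia.
case/negP: uv; apply/eqP; apply: cidJ => //.
have [_ ju] := jumpP u1 u2; have [_ jv] := jumpP v1 v2.
by have := cidN c; lia.
Qed.

End DistinctSums.

(** * Assembling the orientation and the labelling *)

Theorem even_regular_antimagic (T : finType) (e : rel T) (d : nat) :
  simple_graph e -> regular e (2 * d) -> 2 <= d -> antimagic_orientation e.
Proof.
move=> [esym eirr] ereg hd.
have [J [N [pv [sg [[JN N1 rN rJ] cA pvP len_last len_first]]]]] :=
  graph_segments esym eirr ereg hd.
have pvI : injective pv.
  move=> u v uv; have [ru Ju _ _] := pvP u; have [rv Jv _ _] := pvP v.
  have r : fingraph.root e u = fingraph.root e v by rewrite -ru uv rv.
  apply: rJ (r) _; move: Ju; rewrite uv Jv (rN _ _ r).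
  have := JN u; have := JN v; rewrite (rN _ _ r).
  by case: (J u); case: (J v) => //=; lia.
have [nx pvK nxK] := injF_bij pvI.
have rnx v : fingraph.root e (nx v) = fingraph.root e v.
  by have [<- _ _ _] := pvP (nx v); rewrite nxK.
have nxJ v : J (nx v) = next_index (N v) (J v).
  have [_ + _ _] := pvP (nx v); rewrite nxK (rN _ _ (rnx v)) /next_index.
  have := JN (nx v); have := JN v; have := N1 v; rewrite (rN _ _ (rnx v)).
  by case: (J (nx v)) => [|j]; case: eqP; lia.
(* Large enough to bound both the component numbers and the component orders. *)
pose K := #|T| + \max_v N v.
pose cid v : nat := enum_rank (fingraph.root e v).
have cidr u v : cid u = cid v -> fingraph.root e u = fingraph.root e v.
  by move=> /val_inj /enum_rank_inj.
have cidK v : cid v < K by rewrite ltn_addr // ltn_ord.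
have NK v : 1 < N v <= K.
  by rewrite N1 (leq_trans (leq_bigmax v)) // leq_addl.
pose key v := seg_key K (cid v) (N v) (J v).
have keyI : injective key.
  by apply: seg_key_vertex_inj => // u v /cidr; [apply: rN|apply: rJ].
pose src v := if odd (J v) then v else pv v.
pose wk v := if odd (J v) then rev (belast (pv v) (sg v)) else sg v.
have snkE v : last (src v) (wk v) = if odd (J v) then pv v else v.
  rewrite /src /wk; have [_ _ lv _] := pvP v; case: ifP => // _.
  by rewrite -[X in last X _]lv last_rev_belast.
have size_wk v : size (wk v) = size (sg v).
  by rewrite /wk; case: ifP => // _; rewrite size_rev size_belast.
have cA' a : \sum_v count_mem a (und (walk_arcs (src v) (wk v))) = e a.1 a.2.
  rewrite -cA; apply: eq_bigr => v _; rewrite /src /wk.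
  have [_ _ lv _] := pvP v; case: ifP => // _.
  by rewrite -[X in walk_arcs X _]lv count_und_rev.
have [D [L [out [oD injL rgL outE vE]]]] := segment_labelling ereg keyI cA'.
exists D; split=> //; exists L; split=> //; split=> // u v uv.
pose len v := size (sg v).
have pvE u' v' : (pv u' == v') = (u' == nx v').
  by rewrite -[in RHS](inj_eq pvI) nxK.
have offE q : offset wk key q = \sum_(u | key u < q) len u.
  by apply: eq_bigr => w _; apply: size_wk.
(* The out-degree is [d - 1] at a sink, [d + 1] at a source and [d] at a base point of odd order,
   which accounts for the successors in [shifted_sum]. *)
suff shE w : (vsum D L w = shifted_sum K cid J N len nx w - d%:Z)%R.
  move: uv; rewrite !shE => /addIr; apply: shifted_sum_inj => //.
  - by move=> x y /cidr; apply: rN.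
  - by move=> x y /cidr; apply: rJ.
  - by move=> x; rewrite /cid rnx.
  - exact: can_inj nxK.
  - by move=> x; have [] := pvP x.
have snk_count : \sum_i (last (src i) (wk i) == w) =
                 ~~ odd (J w) + odd (J (nx w)).
  rewrite (eq_bigr (fun i => (if i == w then ~~ odd (J i) : nat else 0) +
    (if i == nx w then odd (J i) : nat else 0))); last first.
    by move=> i _; rewrite snkE -pvE; case: (odd (J i)) => /=;
       do 2 case: (_ == w).
  by rewrite big_split /= -!big_mkcond !big_pred1_eq.
have src_count : \sum_i (src i == w) = odd (J w) + ~~ odd (J (nx w)).
  rewrite (eq_bigr (fun i => (if i == w then odd (J i) : nat else 0) +
    (if i == nx w then ~~ odd (J i) : nat else 0))); last first.
    by move=> i _; rewrite /src -pvE; case: (odd (J i)) => /=;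
       do 2 case: (_ == w).
  by rewrite big_split /= -!big_mkcond !big_pred1_eq.
have := outE w; rewrite snk_count src_count vE.
pose off i := \sum_(u | key u < key i) len u.
rewrite (eq_bigr (fun i =>
  (if i == w then (if odd (J i) then - (off i)%:Z else (off i + len i)%:Z)
   else 0)
  + (if i == nx w then (if odd (J i) then (off i + len i)%:Z else - (off i)%:Z)
     else 0))%R); last first.
  move=> i _; rewrite snkE -pvE offE size_wk -/(off i) -/(len i) /src.
  by case: (odd (J i)) => /=; do 2 case: (_ == w); lia.
rewrite big_split /= -!big_mkcond !big_pred1_eq /shifted_sum -/key.
rewrite -/(key (nx w)) -/(off w) -/(off (nx w)) nxJ /next_index.
case: (boolP (odd (J w))) => oJ; case: eqP => jl /=; rewrite ?oJ /=; lia.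
Qed.

Theorem theorem2 (d k : nat) (hd : 2 <= d) :
  exists N : nat,
    forall (T : finType) (e : rel T),
      simple_graph e ->
      regular e (2 * d) ->
      #|odd_components e| = k ->
      (forall C, C \in odd_components e -> N <= #|C|) ->
      antimagic_orientation e.
Proof.
by exists 0 => T e se re _ _; apply: even_regular_antimagic hd.
Qed.
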